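(* Let $\mathcal{M}$ be a compact metric space and $T:\mathcal{M}\to\mathcal{M}$ a homeomorphism. Let $(\psi_i)_{i\ge1}$ be continuous functions $\mathcal{M}\to\mathbb{C}$ and for each $N$ let $\boldsymbol\psi=[\psi_1,\dots,\psi_N]^\top$ and $\mathcal{F}_N=\mathrm{span}\{\psi_1,\dots,\psi_N\}$. For each $N$ let sample points $x_1,\dots,x_N\in\mathcal{M}$ satisfy $x_{i+1}=T(x_i)$ for $i\in\{1,\dots,N-1\}$, put $y_i=T(x_i)$, assume the matrix $\frac1N\sum_{i=1}^N\boldsymbol\psi(x_i)\boldsymbol\psi(x_i)^{\mathsf H}$ is invertible, let $\hat\mu_N=\frac1N\sum_{i=1}^N\delta_{x_i}$, and let $\mathcal{K}_{N,N}:\mathcal{F}_N\to\mathcal{F}_N$ be the EDMD operator built from these $N$ functions and $N$ samples. Let $(\lambda_N)$ be a bounded sequence with $\lambda_N$ an eigenvalue of $\mathcal{K}_{N,N}$, let $\phi_N\in\mathcal{F}_N$ be an associated eigenfunction with $\|\phi_N\|_{C(\mathcal{M})}=\sup_{x\in\mathcal{M}}|\phi_N(x)|=1$, and let $\nu_N=\phi_N\,d\hat\mu_N$. Then there exist a subsequence $(N_i)_{i=1}^\infty$, complex-valued Borel measures $\nu,\mu$ on $\mathcal{M}$ and $\lambda\in\mathbb{C}$ such that $\nu_{N_i}\to\nu$ and $\hat\mu_{N_i}\to\mu$ weakly, $\lambda_{N_i}\to\lambda$, and \[ \int_{\mathcal{M}}h\circ T^{-1}\,d\nu=\lambda\int_{\mathcal{M}}h\,d\nu\quad\forall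 h\in C(\mathcal{M}). \] In addition, $\mu$ is invariant under $T$, and, assuming the Koopman operator $\mathcal{K}:L_2(\mu)\to L_2(\mu)$, $\mathcal{K}\phi=\phi\circ T$, is bounded with $L_2(\mu)$-adjoint $\mathcal{K}^\star$, \[ \int_{\mathcal{M}}\mathcal{K}^\star h\,d\nu=\lambda\int_{\mathcal{M}}h\,d\nu\quad\forall h\in C(\mathcal{M}). \] Furthermore, if $\lambda\neq0$, then \[ \int_{\mathcal{M}}h\circ T\,d\nu=\frac1\lambda\int_{\mathcal{M}}h\,d\nu\quad\forall h\in C(\mathcal{M}), \] i.e., if nonzero, $\nu$ is an eigenmeasure of the Perron–Frobenius operator $(\mathcal{P}\eta)(A)=\eta(T^{-1}(A))$ with eigenvalue $1/\lambda$.
   Context: EDMD operator: with $\boldsymbol\psi(\boldsymbol X)=[\boldsymbol\psi(x_1),\dots,\boldsymbol\psi(x_N)]$, $\boldsymbol\psi(\boldsymbol Y)=[\boldsymbol\psi(y_1),\dots,\boldsymbol\psi(y_N)]$, set $A=\boldsymbol\psi(\boldsymbol Y)\boldsymbol\psi(\boldsymbol X)^\dagger$ (Moore–Penrose pseudoinverse) and $\mathcal{K}_{N,N}(c^{\mathsf H}\boldsymbol\psi)=c^{\mathsf H}A\boldsymbol\psi$, $c\in\mathbb{C}^N$. $\nu_N=\phi_N\,d\hat\mu_N$ is the measure $h\mapsto\frac1N\sum_{i=1}^N h(x_i)\phi_N(x_i)$. Weak convergence of measures $\eta_i\to\eta$ means $\int f\,d\eta_i\to\int f\,d\eta$ for all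 continuous $f$. $\mu$ is invariant if $\int f\circ T\,d\mu=\int f\,d\mu$ for all continuous $f$. *)

(* Defs.v *)
From HB Require Import structures.
From mathcomp Require Import all_boot all_order all_algebra.
From mathcomp Require Import complex.
From mathcomp Require Import all_classical all_reals all_analysis.
Set Implicit Arguments. Unset Strict Implicit. Unset Printing Implicit Defensive.
Import Order.TTheory GRing.Theory Num.Theory.
Import numFieldNormedType.Exports.
Local Open Scope classical_set_scope.
Local Open Scope ring_scope.

(* nonempty metric spaces (measurable types in mathcomp-analysis are pointed) *)
#[short(type="pointedMetricType")]
HB.structure Definition PointedMetric (K : numDomainType) :=
  {M of Pointed M & Metric K M}.

Section Defs.
Variable R : realType.
Local Notation C := R[i].
Variable M : pointedMetricType R.

Definition borel := g_sigma_algebraType (@open M).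

Definition cabs (z : C) : R := Num.sqrt (complex.Re z ^+ 2 + complex.Im z ^+ 2).

Definition ccontinuous (f : M -> C) :=
  continuous (fun y => complex.Re (f y)) /\ continuous (fun y => complex.Im (f y)).

Definition ccvg (u : nat -> C) (l : C) :=
  (fun n => cabs (u n - l)) @ \oo --> (0 : R).

Definition supnorm (f : M -> C) : R := sup (range (fun y => cabs (f y))).

Definition rint (mu : {measure set borel -> \bar R}) (f : M -> R) : R :=
  Rintegral mu setT (f : borel -> R).
Definition cintm (mu : {measure set borel -> \bar R}) (h : M -> C) : C :=
  Complex (rint mu (fun y => complex.Re (h y))) (rint mu (fun y => complex.Im (h y))).

(* complex Borel measure nu = (nu1 - nu2) + i (nu3 - nu4), nu_k finite
   nonnegative Borel measures (every complex Borel measure is of this form) *)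
Record cmeasure := CMeasure {
  cm1 : {finite_measure set borel -> \bar R};
  cm2 : {finite_measure set borel -> \bar R};
  cm3 : {finite_measure set borel -> \bar R};
  cm4 : {finite_measure set borel -> \bar R} }.

Definition cint (nu : cmeasure) (h : M -> C) : C :=
  (cintm (cm1 nu) h - cintm (cm2 nu) h)
  + Complex 0 1 * (cintm (cm3 nu) h - cintm (cm4 nu) h).

Definition emp_int (N : nat) (x : nat -> M) (h : M -> C) : C :=
  (N%:R)^-1 * \sum_(i < N) h (x i).
Definition emp_wint (N : nat) (x : nat -> M) (phi : M -> C) (h : M -> C) : C :=
  (N%:R)^-1 * \sum_(i < N) h (x i) * phi (x i).

Definition ctmx m n (A : 'M[C]_(m, n)) : 'M[C]_(n, m) :=
  \matrix_(i, j) conjc (A j i).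

Definition is_mpinv m n (A : 'M[C]_(m, n)) (P : 'M[C]_(n, m)) :=
  [/\ A *m P *m A = A, P *m A *m P = P,
      ctmx (A *m P) = A *m P & ctmx (P *m A) = P *m A].
Definition mpinv m n (A : 'M[C]_(m, n)) : 'M[C]_(n, m) :=
  xget 0 [set P | is_mpinv A P].

Variable psi : nat -> M -> C.   (* psi j = psi_{j+1} *)
Variable T : M -> M.

Definition psivec N (y : M) : 'cV[C]_N := \col_(j < N) psi j y.
Definition psiX N (x : nat -> M) : 'M[C]_N := \matrix_(j < N, i < N) psi j (x i).
Definition psiY N (x : nat -> M) : 'M[C]_N :=
  \matrix_(j < N, i < N) psi j (T (x i)).
Definition gram N (x : nat -> M) : 'M[C]_N :=
  (N%:R)^-1 *: \sum_(i < N) (psivec N (x i) *m ctmx (psivec N (x i))).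
Definition edmd_mx N (x : nat -> M) : 'M[C]_N := psiY N x *m mpinv (psiX N x).
(* K_{N,N} (c^H psi) = c^H A psi *)
Definition edmd_op N (x : nat -> M) (c : 'cV[C]_N) : M -> C :=
  fun y => (ctmx c *m edmd_mx N x *m psivec N y) 0 0.
Definition of_coef N (c : 'cV[C]_N) : M -> C :=
  fun y => (ctmx c *m psivec N y) 0 0.

Definition edmd_eigenpair N (x : nat -> M) (lam : C) (phi : M -> C) :=
  (exists y, phi y != 0) /\
  exists c : 'cV[C]_N, phi = of_coef c /\
    (forall y, edmd_op x c y = lam * phi y).

Definition L2 (mu : {measure set borel -> \bar R}) (f : M -> C) :=
  [/\ measurable_fun setT ((fun y => complex.Re (f y)) : borel -> R),
      measurable_fun setT ((fun y => complex.Im (f y)) : borel -> R) &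
      mu.-integrable setT ((fun y => (cabs (f y) ^+ 2)%:E) : borel -> \bar R)].
Definition cinner (mu : {measure set borel -> \bar R}) (f g : M -> C) : C :=
  cintm mu (fun y => f y * conjc (g y)).

Definition koopman_bounded (mu : {measure set borel -> \bar R}) :=
  exists K : R, forall f, L2 mu f ->
    L2 mu (f \o T) /\
    rint mu (fun y => cabs (f (T y)) ^+ 2) <= K * rint mu (fun y => cabs (f y) ^+ 2).

Definition koopman_adjoint (mu : {measure set borel -> \bar R})
    (Kstar : (M -> C) -> (M -> C)) :=
  forall g, L2 mu g ->
    L2 mu (Kstar g) /\
    forall f, L2 mu f -> cinner mu (f \o T) g = cinner mu f (Kstar g).

End Defs.

(* Main.v *)
Require Import Defs.
From HB Require Import structures.
From mathcomp Require Import all_boot all_order all_algebra.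
From mathcomp Require Import all_classical all_reals all_analysis.
From mathcomp Require Import zify ring lra complex measurable_realfun.
Import Order.TTheory GRing.Theory Num.Theory.
Import numFieldNormedType.Exports.
Local Open Scope classical_set_scope.
Local Open Scope ring_scope.

(** A compact metric space is the image of the Cantor space.  Lifting the sample
    points there, a diagonal extraction makes the masses of all cylinders
    converge, for the positive and negative parts of Re phi_N and Im phi_N, for
    their complements to 1 and for the weight 1.  The limiting cylinder masses
    are realised by Lebesgue measure on an interval, through the inverse of the
    distribution function, and pushed forward to the space.

    Since the Gram matrix is invertible, phi_N (T x_i) = lambda_N phi_N (x_i)
    at every sample point, so the two sides of the eigenvalue identity differ
    by a telescoping sum of size O(1/N).  A finite measure being determined by
    its integrals of continuous functions, mu is invariant on measurable sets
    and is the sum of each part of nu and of the complementary measure, so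
    mu-null sets are nu-null.  Testing the adjoint relation on
    g = K* h - h o T^-1 gives |g|^2 a zero integral, hence K* h = h o T^-1
    almost everywhere for mu, and for nu. *)

(** * Integrals of bounded functions against a finite measure *)

Section finite_measure_integral.
Context {d} {T : measurableType d} {R : realType}.
Variable P : {finite_measure set T -> \bar R}.

Lemma integrable_bounded (u : T -> R) B : measurable_fun [set: T] u ->
  (forall t, `|u t| <= B) -> P.-integrable [set: T] (EFin \o u).
Proof.
move=> mu uB; apply: measurable_bounded_integrable => //.
  by rewrite ltey_eq fin_num_measure.
by exists B; split; rewrite ?num_real// => c Bc t _; exact: le_trans (uB t) (ltW Bc).
Qed.

Lemma Rintegral_simple n (a : nat -> R) (A : nat -> set T) :
  (forall k, measurable (A k)) ->
  \int[P]_t (\sum_(k < n) a k * \1_(A k) t) = \sum_(k < n) a k * fine (P (A k)).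
Proof.
move=> mA.
have mt k : measurable_fun [set: T] (fun t => a k * \1_(A k) t).
  by apply: measurable_funM => //; exact: measurable_indic.
have tB k t : `|a k * \1_(A k) t| <= `|a k|.
  by rewrite normrM ler_piMr// indicE; case: (t \in A k); rewrite ?normr1 ?normr0.
elim: n => [|n IHn].
  rewrite big_ord0; under eq_Rintegral do rewrite big_ord0.
  by rewrite Rintegral_cst// mul0r.
rewrite big_ord_recr -IHn /=; under eq_Rintegral do rewrite big_ord_recr /=.
rewrite RintegralD//; last 2 first.
- apply: (integrable_bounded _ (\sum_(k < n) `|a k|)).
    exact: measurable_sum.
  by move=> t; apply: le_trans (ler_norm_sum _ _ _) _; exact: ler_sum.
- exact: integrable_bounded (tB n).
congr (_ + _); rewrite RintegralZl//; last first.
  apply: (integrable_bounded _ 1); first exact: measurable_indic.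
  by move=> t; rewrite indicE; case: (t \in A n); rewrite ?normr1 ?normr0.
by rewrite /Rintegral integral_indic// setIT.
Qed.

End finite_measure_integral.

(** * Borel measurability, distance to a set, and finite measures tested on continuous functions *)

Section borel.
Context {R : realType} {M : pointedMetricType R}.
Local Notation borelM := (borel M).

Lemma continuous_borel_measurable (f : M -> R) :
  continuous f -> measurable_fun [set: borelM] (f : borelM -> R).
Proof.
move=> /continuousP cf; apply: (measurability _ (RGenOpens.measurableE R)).
move=> _ [_ [a [b ->] <-]]; rewrite setTI; apply: sub_sigma_algebra.
exact/cf/interval_open.
Qed.

Lemma continuous_self_map_measurable (f : M -> M) :
  continuous f -> measurable_fun [set: borelM] (f : borelM -> borelM).
Proof.
move=> /continuousP cf; apply: (@measurability _ _ borelM borelM setT f (@open M) erefl).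
by move=> _ [A oA <-]; rewrite setTI; apply: sub_sigma_algebra; exact: cf.
Qed.

Lemma compact_continuous_bounded (f : M -> R) :
  compact [set: M] -> continuous f -> exists K, forall y, `|f y| <= K.
Proof.
move=> cM cf; have [K [_ bK]] : bounded_set (f @` setT).
  apply: compact_bounded; apply: continuous_compact => //.
  exact: continuous_subspaceT.
exists (K + 1) => y; apply: (bK (K + 1)); first by rewrite ltrDl.
by exists y.
Qed.

Lemma continuous_borel_integrable (mu : {finite_measure set borelM -> \bar R})
    (f : M -> R) : compact [set: M] -> continuous f ->
  mu.-integrable setT (EFin \o (f : borelM -> R)).
Proof.
move=> cM cf; have [K bK] := compact_continuous_bounded f cM cf.
exact: integrable_bounded (continuous_borel_measurable _ cf) bK.
Qed.

(** For empty [F] the infimum takes its default value 0, hence the case splits on [F] below. *)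
Definition infdist (F : set M) (y : M) : R := inf [set mdist y z | z in F].

Lemma infdist_has_inf (F : set M) y : F !=set0 ->
  has_inf [set mdist y z | z in F].
Proof.
move=> [z Fz]; split; first by exists (mdist y z), z.
by exists 0 => _ [w _ <-]; exact: mdist_ge0.
Qed.

Lemma infdist_ge0 (F : set M) y : 0 <= infdist F y.
Proof.
have [->|/set0P F0] := eqVneq F set0; first by rewrite /infdist image_set0 inf0.
apply: lb_le_inf; first by case: (infdist_has_inf F y F0).
by move=> _ [w _ <-]; exact: mdist_ge0.
Qed.

Lemma infdist_lip (F : set M) y z : infdist F y <= infdist F z + mdist y z.
Proof.
have [->|/set0P F0] := eqVneq F set0.
  by rewrite /infdist !image_set0 inf0 add0r mdist_ge0.
rewrite -lerBlDr; apply: lb_le_inf; first by case: (infdist_has_inf F z F0).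
move=> _ [w Fw <-]; rewrite lerBlDr.
apply: le_trans (_ : mdist y w <= _); last first.
  by rewrite addrC metric_triangle.
by apply: ge_inf; [case: (infdist_has_inf F y F0)|exists w].
Qed.

Lemma infdist_continuous (F : set M) : continuous (infdist F).
Proof.
move=> y; apply/cvgrPdist_lt => e e0; near=> z.
have yz : mdist y z < e.
  by near: z; apply/nbhs_ballP; exists e => //= z; rewrite ballEmdist.
rewrite ltr_norml; have := infdist_lip F y z; have := infdist_lip F z y.
by rewrite (metric_sym z y); lra.
Unshelve. all: by end_near. Qed.

Lemma infdist_gt0 (F : set M) y : F !=set0 -> closed F -> ~ F y ->
  0 < infdist F y.
Proof.
move=> F0 cF Fy; have : nbhs y (~` F).
  by apply: open_nbhs_nbhs; split; rewrite ?openC.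
move=> /nbhs_ballP[e /= e0 eF]; apply: lt_le_trans e0 _.
apply: lb_le_inf; first by case: (infdist_has_inf F y F0).
move=> _ [w Fw <-]; rewrite leNgt; apply/negP => yw.
by apply: (eF w) => //; rewrite ballEmdist.
Qed.

Lemma infdist_eq0 (F : set M) y : F y -> infdist F y = 0.
Proof.
move=> Fy; apply/eqP; rewrite eq_le infdist_ge0 andbT -(mdistxx y).
by apply: ge_inf; [exact: (infdist_has_inf F y (ex_intro _ y Fy)).2|exists y].
Qed.

(* The integrals of min(1, n d(y, F)) determine the mass of the complement of
   the closed set F. *)
Lemma finite_measure_ext (m1 m2 : {finite_measure set borelM -> \bar R}) :
  compact [set: M] ->
  (forall f : M -> R, continuous f -> rint m1 f = rint m2 f) ->
  forall A, measurable A -> m1 A = m2 A.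
Proof.
move=> cM H A mA.
apply: (@measure_unique _ R borelM (@open M) (fun=> setT)) => //.
- by move=> ? ? ? ?; exact: openI.
- by move=> _; exact: openT.
- by rewrite bigcup_const //; exists 0%N.
- move=> U oU.
  (* The whole space is treated apart: its complement is empty, where [infdist] is constantly 0 and
     [g] below would vanish. *)
  have [->|/eqP UT] := eqVneq U setT.
    have : rint m1 (cst 1) = rint m2 (cst 1) by apply: H => y; exact: cvg_cst.
    rewrite /rint !Rintegral_cst// !mul1r => e.
    by rewrite -[LHS]fineK ?fin_num_measure// e fineK// fin_num_measure.
  have F0 : ~` U !=set0.
    by apply/set0P/eqP => UC; apply: UT; rewrite -(setCK U) UC setC0.
  pose g n (y : M) : R := Num.min 1 (n%:R * infdist (~` U) y).
  have g0 n y : 0 <= g n y.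
    by rewrite /g le_min ler01 mulr_ge0// infdist_ge0.
  have cg n : continuous (g n).
    move=> y; apply: (@continuous_min R M (cst 1) (fun y => n%:R * infdist (~` U) y)).
      exact: cvg_cst.
    by apply: cvgM; [exact: cvg_cst|exact: infdist_continuous].
  have eqg n (m : {finite_measure set borelM -> \bar R}) :
      (\int[m]_(y in setT) (g n y)%:E = (rint m (g n))%:E)%E.
    rewrite /rint /Rintegral fineK//; apply: integrable_fin_num => //.
    exact: continuous_borel_integrable.
  suff main (m : {finite_measure set borelM -> \bar R}) :
      (rint m (g n))%:E @[n --> \oo] --> m U.
    have e12 : (fun n => (rint m1 (g n))%:E) = (fun n => (rint m2 (g n))%:E).
      by apply/funext => n; rewrite H.
    by apply: (cvg_unique _ (main m1)) => //; rewrite e12; exact: main.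
  under eq_fun do rewrite -eqg.
  rewrite -[U]setIT -integral_indic//; last exact: sub_sigma_algebra.
  (* [g n] increases pointwise to the indicator of [U]: on [U] the distance to the closed complement
     is positive, elsewhere it is 0. *)
  have -> : (fun y : borelM => (\1_U y)%:E) = (fun y => limn (fun n => (g n y)%:E)) :> (borelM -> \bar R).
    apply/funext => y; apply/esym/cvg_lim => //; apply: cvg_EFin.
      exact: nearW.
    rewrite indicE; have [/set_mem Uy|/negP yU] := boolP (y \in U).
      have d0 : 0 < infdist (~` U) y.
        by apply: infdist_gt0 => //; exact: open_closedC.
      apply: cvg_near_cst; near=> n; rewrite /= /g min_l//.
      rewrite -ler_pdivrMr// mul1r.
      by near: n; exact: nbhs_infty_ger.
    apply: cvg_near_cst; near=> n; rewrite /= /g infdist_eq0 ?mulr0 ?min_r//.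
    by move=> Uy; apply: yU; exact/mem_set.
  apply: cvg_monotone_convergence => //.
  - by move=> n; apply/measurable_EFinP; exact: continuous_borel_measurable.
  - by move=> n y _; rewrite lee_fin.
  - move=> y _ n k nk; rewrite lee_fin /g le_min2// ler_wpM2r ?infdist_ge0//.
    by rewrite ler_nat.
- by move=> _; rewrite ltey_eq fin_num_measure.
Unshelve. all: by end_near. Qed.

End borel.

(** * Diagonal extraction through an ultrafilter *)

Lemma ultrafilter_fmap {S T : Type} (f : S -> T) (U : set_system S) :
  UltraFilter U -> UltraFilter (f @ U).
Proof.
move=> UU; split; first exact: fmap_proper_filter.
move=> G PG UG; apply/seteqP; split=> // A GA.
have [//|UnA] := in_ultra_setVsetC (f @^-1` A) UU.
have : G (A `&` ~` A) by apply: filterI => //; exact: UG.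
by rewrite setICr => /filter_not_empty.
Qed.

(* The values along an ultrafilter finer than \oo converge; a subsequence is
   then picked inside the members of the ultrafilter. *)
Lemma bounded_subsequence {R : realType} {I : countType} (v : I -> nat -> R)
    (B : I -> R) :
  (forall i N, (0 < N)%N -> `|v i N| <= B i) ->
  exists Ns : nat -> nat, exists l : I -> R,
    (forall k, (0 < Ns k)%N /\ (Ns k < Ns k.+1)%N) /\
    forall i, v i (Ns k) @[k --> \oo] --> l i.
Proof.
move=> vB; have [U [UU subU]] := ultraFilterLemma (@eventually_filter).
have cvgU i : exists l : R, v i @ U --> l.
  have := @segment_compact R (- B i) (B i).
  rewrite compact_ultra => segc.
  have UvB : U (v i @^-1` `[- B i, B i]%classic).
    by apply: subU; exists 1%N => // N /= N0; rewrite in_itv /= -ler_norml vB.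
  by have [l [_ vl]] := segc _ (ultrafilter_fmap (v i) U UU) UvB; exists l.
have [l vl] := choice cvgU.
(* One diagonal step: past the index [km.2] there is a common index at which all coordinates with
   [pickle] at most [km.1] are close to their limits, since finitely many members of [U] intersect
   in a member. *)
have step (km : nat * nat) : exists N, (km.2 < N)%N /\ forall i : I,
    (pickle i <= km.1)%N -> `|l i - v i N| < km.1.+1%:R^-1.
  case: km => k m /=.
  have Um : U [set N | (m < N)%N] by apply: (subU [set N | (m < N)%N]); exists m.+1.
  have Uj (j : 'I_k.+1) : U [set N | forall i : I, pickle i = j ->
      `|l i - v i N| < k.+1%:R^-1].
    (* A number that is the code of no [i] imposes a vacuous condition. *)
    case: (pselect (exists i : I, pickle i = j)) => [[i ij]|no]; last first.
      by apply: filterS filterT => N _ i ij; exfalso; apply: no; exists i.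
    have /cvgrPdist_lt /(_ k.+1%:R^-1) := vl i.
    rewrite invr_gt0 ltr0n => /(_ isT).
    apply: filterS => N /= lN i' i'j.
    by rewrite (pcan_inj pickleK (etrans i'j (esym ij))).
  have [N [mN jN]] : exists N, (m < N)%N /\ forall j : 'I_k.+1,
      forall i : I, pickle i = j -> `|l i - v i N| < k.+1%:R^-1.
    apply: (@filter_ex _ U); apply: filterI => //.
    exact: filter_forall.
  by exists N; split=> // i ik; apply: (jN (Ordinal (ik : (pickle i < k.+1)%N))).
have [nxt nxtP] := choice step.
(* [Ns k] is chosen with precision index [k] for every [k], 0 included; starting past 0 makes [Ns 0]
   positive. *)
pose Ns := fix Ns k := if k is k'.+1 then nxt (k, Ns k') else nxt (0%N, 0%N).
exists Ns, l; split.
  move=> k; split; last by have [] := nxtP (k.+1, Ns k).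
  case: k => [|k]; first by have [] := nxtP (0%N, 0%N).
  by have [/= + _] := nxtP (k.+1, Ns k); apply: leq_ltn_trans.
have lNs k i : (pickle i <= k)%N -> `|l i - v i (Ns k)| < k.+1%:R^-1.
  case: k => [|k] ik; first exact: (nxtP (0%N, 0%N)).2.
  exact: (nxtP (k.+1, Ns k)).2.
move=> i; apply/cvgrPdist_lt => e e0; near=> k.
have ik : (pickle i <= k)%N by near: k; exact: nbhs_infty_ge.
apply: lt_trans (lNs k i ik) _.
by near: k; exact: near_infty_natSinv_lt (PosNum e0).
Unshelve. all: by end_near. Qed.

(** * Binary codes of Cantor prefixes, and a measure with prescribed cylinder masses *)

Fixpoint code (n : nat) (b : nat -> bool) : nat :=
  if n is n'.+1 then (code n' b).*2 + b n' else 0.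

Lemma code_lt n b : (code n b < 2 ^ n)%N.
Proof.
elim: n => //= n IHn; rewrite expnS.
by case: (b n); lia.
Qed.

(** Appending a bit never crosses an even threshold; this yields the compatibility [Gdouble] between
    consecutive levels. *)
Lemma codeS_lt_double n k b : (code n.+1 b < k.*2)%N = (code n b < k)%N.
Proof.
by rewrite /=; case: (b n); lia.
Qed.

Lemma code_prefix {n n' b b'} : (n <= n')%N -> code n' b = code n' b' ->
  code n b = code n b'.
Proof.
move=> /subnK <-; elim: (n' - n)%N => // m IHm /= e; apply: IHm.
move: e; rewrite addnC [RHS]addnC => /(congr1 half).
by rewrite !half_bit_double.
Qed.

Lemma code_bit n b b' : code n.+1 b = code n.+1 b' -> b n = b' n.
Proof.
by rewrite /= => /(congr1 odd); rewrite !oddD !odd_double; case: (b n) (b' n) => [] [].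
Qed.

(* [G n k] prescribes the mass of the sequences with [code n] below [k]; the
   inverse of the resulting distribution function carries Lebesgue measure
   on [0, G 0 1[ to a measure with this prescription. *)
Section decode.
Context {R : realType} (G : nat -> nat -> R).
Hypothesis G0 : forall n, G n 0 = 0.
Hypothesis Gmono : forall n, {homo G n : k l / (k <= l)%N >-> k <= l}.
Hypothesis Gdouble : forall n k, G n.+1 k.*2 = G n k.

(** Bisection: the current cell is cut at the value of [G] at the odd index between its two halves,
    and comparing [t] with it supplies the next bit. For [t] in [[0, G 0 1[] this finds the interval
    [[G n k, G n k.+1[] containing [t]. *)
Fixpoint cell (n : nat) (t : R) : nat :=
  if n is n'.+1 then (cell n' t).*2 + (G n (cell n' t).*2.+1 <= t)%R else 0.

Definition decode (t : R) (n : nat) : bool := G n.+1 (cell n t).*2.+1 <= t.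

Lemma code_decode n t : code n (decode t) = cell n t.
Proof. by elim: n => //= n ->. Qed.

Lemma cell_itv n t : 0 <= t < G 0 1 -> G n (cell n t) <= t < G n (cell n t).+1.
Proof.
move=> t0; elim: n => [|n /andP[Gt tG]] /=; first by rewrite G0.
have [Gt'|Gt'] := leP (G n.+1 (cell n t).*2.+1) t.
  by rewrite addn1 Gt' -doubleS Gdouble.
by rewrite addn0 Gt' Gdouble Gt.
Qed.

Lemma cell_eq n k t : 0 <= t < G 0 1 ->
  (cell n t == k) = (G n k <= t < G n k.+1).
Proof.
move=> t0; have /andP[Gt tG] := cell_itv n t t0.
apply/eqP/idP => [<-|/andP[kt tk]]; first by rewrite Gt tG.
apply/eqP; rewrite eqn_leq; apply/andP; split; rewrite leqNgt; apply/negP => /(Gmono n).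
  by move=> /le_trans /(_ Gt); rewrite leNgt tk.
by move=> /le_trans /(_ kt); rewrite leNgt tG.
Qed.

Lemma measurable_cell n k : measurable [set t : R | cell n t = k].
Proof.
elim: n k => [|n IHn] k /=.
  case: (eqVneq 0%N k) => [<-|/eqP k0].
    by rewrite (_ : [set _ | _] = setT)//; apply/seteqP; split.
  by rewrite (_ : [set _ | _] = set0)//; apply/seteqP; split.
have -> : [set t | ((cell n t).*2 + (G n.+1 (cell n t).*2.+1 <= t)%R)%N = k] =
    [set t | cell n t = k./2] `&`
    (if odd k then `[G n.+1 k./2.*2.+1, +oo[ else `]-oo, G n.+1 k./2.*2.+1[)%classic.
  apply/seteqP; split=> t /=.
    move=> <-; rewrite addnC half_bit_double oddD odd_double addbF.
    by split=> //; case: leP => /= Gt; rewrite in_itv /= ?andbT.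
  case=> ->; rewrite -[RHS]odd_double_half addnC; case: (odd k) => /=.
    by rewrite in_itv /= andbT => ->.
  by rewrite in_itv /= leNgt => ->.
by apply: measurableI => //; case: (odd k).
Qed.

(** Within [[0, G 0 1[] the cell [k] is exactly the interval [[G n k, G n k.+1[], whose length is
    the prescribed mass. The bound on [k] keeps this interval inside [[0, G 0 1[], since
    [G n (2 ^ n) = G 0 1]. *)
Lemma cell_law : exists P : {finite_measure set (measurableTypeR R) -> \bar R},
  forall n k, (k < 2 ^ n)%N ->
    P [set t | cell n t = k] = (G n k.+1 - G n k)%:E.
Proof.
have mI : measurable (`[0%R, G 0 1[%classic : set (measurableTypeR R)) by [].
have Ioo : (@lebesgue_measure R `[0%R, G 0 1[%classic < +oo)%E.
  by rewrite lebesgue_measure_itv /=; case: ifP => //; rewrite ?lte_fin -?EFinB ltry.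
exists (mfrestr mI Ioo) => n k k2.
have Gn2 : G n (2 ^ n) = G 0 1.
  by elim: (n) => // m IHm; rewrite expnS mul2n Gdouble.
have G01 l : (l <= 2 ^ n)%N -> 0 <= G n l <= G 0 1.
  by move=> l2; rewrite -(G0 n) -Gn2 !Gmono.
rewrite /= /mfrestr /mrestr /=.
have -> : [set t | cell n t = k] `&` `[0, G 0 1[ = `[G n k, G n k.+1[%classic.
  apply/seteqP; split=> t /=.
    by case=> nk; rewrite !in_itv /= => t0; rewrite -cell_eq ?nk.
  rewrite !in_itv /= => /andP[kt tk].
  have t0 : 0 <= t < G 0 1.
    have /andP[k0 _] := G01 k (ltnW k2); have /andP[_ k1] := G01 k.+1 k2.
    by rewrite (le_trans k0)//= (lt_le_trans tk).
  by split=> //; apply/eqP; rewrite cell_eq// kt.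
rewrite lebesgue_measure_itv /= lte_fin -EFinB.
(* An empty interval has measure 0, and monotonicity then makes its endpoints equal. *)
case: ltP => // kk; congr EFin; apply/eqP; rewrite eq_sym subr_eq0 eq_le kk Gmono//.
Qed.

End decode.

(** * Images of finite measures *)

Section image_measure.
Context {d d'} {T1 : measurableType d} {T2 : measurableType d'} {R : realType}.
Variables (P : {finite_measure set T1 -> \bar R}) (f : T1 -> T2).
Hypothesis mf : measurable_fun [set: T1] f.

(* [pushforward P f] with the measurability of [f] recorded, so that it is
   canonically a finite measure. *)
Definition image_measure of measurable_fun [set: T1] f : set T2 -> \bar R :=
  pushforward P f.
Local Notation nu := (image_measure mf).

Let measurable_pre A : measurable A -> measurable (f @^-1` A).
Proof. by move=> mA; rewrite -[X in measurable X]setTI; exact: mf. Qed.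

Let nu0 : nu set0 = 0%E.
Proof. by rewrite /image_measure /pushforward preimage_set0 measure0. Qed.

Let nu_ge0 A : (0 <= nu A)%E.
Proof. exact: measure_ge0. Qed.

Let nu_sigma_additive : semi_sigma_additive nu.
Proof.
move=> F mF tF mUF; rewrite /image_measure /pushforward preimage_bigcup.
apply: measure_semi_sigma_additive.
- by move=> n; exact: measurable_pre.
- apply/trivIsetP => /= i j _ _ ij; rewrite -preimage_setI.
  by move/trivIsetP : tF => /(_ _ _ _ _ ij) ->//; rewrite preimage_set0.
- by rewrite -preimage_bigcup; exact: measurable_pre.
Qed.

HB.instance Definition _ := isMeasure.Build _ _ _ nu nu0 nu_ge0 nu_sigma_additive.

Let nu_fin : fin_num_fun nu.
Proof. by move=> A mA; apply: fin_num_measure; exact: measurable_pre. Qed.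

HB.instance Definition _ := Measure_isFinite.Build _ _ _ nu nu_fin.

End image_measure.

(** * Cylinders of the Cantor space and uniform continuity *)

Section cantor_cells.
Implicit Types b : cantor_space.

Lemma open_cantor_cell n k : open [set b : cantor_space | code n b = k].
Proof.
elim: n k => [|n IHn] k /=.
  case: (eqVneq 0%N k) => [<-|/eqP k0].
    by rewrite (_ : [set _ | _] = setT); [exact: openT|apply/seteqP; split].
  by rewrite (_ : [set _ | _] = set0); [exact: open0|apply/seteqP; split].
have -> : [set b : cantor_space | ((code n b).*2 + b n)%N = k] =
    [set b : cantor_space | code n b = k./2] `&`
    (@proj nat (fun=> bool) n @^-1` [set odd k]).
  apply/seteqP; split=> b /=; rewrite /proj.
    by move=> <-; rewrite addnC half_bit_double oddD odd_double addbF oddb.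
  by case=> -> ->; rewrite -[RHS]odd_double_half addnC.
apply: openI => //; apply: open_comp; last exact: discrete_open.
by move=> b _; exact: proj_continuous.
Qed.

(** Otherwise there are points outside [U] sharing ever longer prefixes with [b]; they converge to
    [b] bit by bit, a contradiction. *)
Lemma cantor_cell_basis b (U : set cantor_space) : nbhs b U ->
  exists n, forall b', code n b' = code n b -> U b'.
Proof.
move=> bU; apply: contrapT => /forallNP nU.
have /choice[c cP] n : exists b', code n b' = code n b /\ ~ U b'.
  apply: contrapT => H; apply: (nU n) => b' b'b; apply: contrapT => Ub'.
  by apply: H; exists b'.
have cb : c @ \oo --> b.
  apply/(@pointwise_cvgP nat bool) => i; apply: cvg_near_cst.
  suff : \forall n \near \oo, c n i = b i by [].
  near=> n.
  apply: (code_bit i); apply: (code_prefix _ (cP n).1).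
  by near: n; exact: nbhs_infty_gt.
have [n _ /(_ n (leqnn _))] := cb _ bU.
exact: (cP n).2.
Unshelve. all: by end_near. Qed.

(** By compactness: if every level had a bad pair, the first components would cluster at some [b],
    and a cylinder around [b] on which [g] stays within [e / 2] of [g b] would contain both
    components of a late pair. *)
Lemma cantor_uniform {R : realType} (g : cantor_space -> R) (e : R) :
  continuous g -> 0 < e ->
  exists n, forall b b', code n b = code n b' -> `|g b - g b'| < e.
Proof.
move=> cg e0; apply: contrapT => /forallNP nU.
have /choice[c cP] n : exists bb : cantor_space * cantor_space,
    code n bb.1 = code n bb.2 /\ e <= `|g bb.1 - g bb.2|.
  apply: contrapT => H; apply: (nU n) => b b' bb'; rewrite ltNge; apply/negP => eg.
  by apply: H; exists (b, b').
have [b [_ clb]] : [set: cantor_space] `&` cluster ((fst \o c) @ \oo) !=set0.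
  by apply: cantor_space_compact; exact: filterT.
have e20 : 0 < e / 2 by rewrite divr_gt0.
have /cvgrPdist_lt /(_ _ e20) /cantor_cell_basis[n0 n0P] := cg b.
have [||b1 [[n /= n0n <-] nb]] := clb [set (c n).1 | n in [set n | n0 <= n]%N]
    [set b' : cantor_space | code n0 b' = code n0 b].
- by exists n0 => // n /= n0n; exists n.
- by apply: open_nbhs_nbhs; split=> //; exact: open_cantor_cell.
have [c12] := cP n; apply/negP; rewrite -ltNge.
have := n0P _ nb; have := n0P (c n).2.
rewrite -(code_prefix n0n c12) => /(_ nb) g2 g1.
rewrite (_ : g _ - g _ = (g b - g (c n).2) - (g b - g (c n).1)); last by ring.
by rewrite (le_lt_trans (ler_normB _ _))// [e]splitr ltrD.
Qed.

End cantor_cells.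

(** * Weighted means over sample points *)

Section weighted_means.
Context {R : realType} {M : pointedMetricType R}.

Definition wmean (N : nat) (w : nat -> R) (x : nat -> M) (h : M -> R) : R :=
  N%:R^-1 * \sum_(i < N) w i * h (x i).

Section bounded_weights.
Variables (N : nat) (w : nat -> R) (x : nat -> M).
Hypothesis w01 : forall i, 0 <= w i <= 1.

Lemma wmeanB g h : wmean N w x (fun y => g y - h y) = wmean N w x g - wmean N w x h.
Proof.
rewrite /wmean -mulrBr -sumrB; congr (_ * _).
by apply: eq_bigr => i _; rewrite mulrBr.
Qed.

Lemma le_wmean g h : (forall y, g y <= h y) -> wmean N w x g <= wmean N w x h.
Proof.
move=> gh; rewrite /wmean ler_wpM2l ?invr_ge0//; apply: ler_sum => i _.
by rewrite ler_wpM2l//; case/andP: (w01 i).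
Qed.

Lemma normr_wmean_le h K : 0 <= K -> (forall y, `|h y| <= K) -> `|wmean N w x h| <= K.
Proof.
move=> K0 hK; have [->|N0] := posnP N; first by rewrite /wmean big_ord0 mulr0 normr0.
rewrite /wmean normrM ger0_norm ?invr_ge0// mulrC ler_pdivrMr ?ltr0n//.
apply: le_trans (ler_norm_sum _ _ _) _.
apply: le_trans (_ : \sum_(i < N) K <= _); last by rewrite sumr_const card_ord mulr_natr.
apply: ler_sum => i _; have /andP[w0 w1] := w01 i.
by rewrite normrM ger0_norm// -[K]mul1r ler_pM.
Qed.

End bounded_weights.

Lemma wmean_sum N w x n (a : nat -> R) (g : nat -> M -> R) :
  wmean N w x (fun y => \sum_(k < n) a k * g k y) =
  \sum_(k < n) a k * wmean N w x (g k).
Proof.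
rewrite /wmean; under [RHS]eq_bigr do rewrite mulrCA mulr_sumr.
rewrite -mulr_sumr exchange_big /=; congr (_ * _).
by apply: eq_bigr => i _; rewrite mulr_sumr; apply: eq_bigr => k _; rewrite mulrCA.
Qed.

End weighted_means.

(** * Limits of weighted means realised as measures *)

Section cell_measure.
Context {R : realType} {M : pointedMetricType R}.
Variables (f : cantor_space -> M) (s : M -> cantor_space).
Hypothesis cM : compact [set: M].
Hypothesis cf : continuous f.
Hypothesis fs : cancel s f.

(** Cylinders are counted cumulatively, so that the limits of the means form a distribution function
    as in [cell_law]. *)
Definition cell_below (n k : nat) (y : M) : R := (code n (s y) < k)%N%:R.

Lemma sum_cell n (a : nat -> R) m : (m < 2 ^ n)%N ->
  \sum_(k < 2 ^ n) a k * (m == k)%:R = a m.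
Proof.
move=> m2; rewrite (bigD1 (Ordinal m2)) //= eqxx mulr1 big1 ?addr0// => k km.
by rewrite eq_sym -(inj_eq val_inj) in km; rewrite (negbTE km) mulr0.
Qed.

(** [h \o f] is uniformly close to a function constant on the cylinders of one level. For such a
    step function the means are combinations of those of [cell_below], and their limit is its
    integral under the measure of [cell_law]. The image of that measure under [f \o decode G] serves
    every [h]. *)
Lemma cell_measure (N : nat -> nat) (w : nat -> nat -> R) (x : nat -> nat -> M)
    (G : nat -> nat -> R) :
  (forall j i, 0 <= w j i <= 1) ->
  (forall n k, wmean (N j) (w j) (x j) (cell_below n k) @[j --> \oo] --> G n k) ->
  exists nu : {finite_measure set (borel M) -> \bar R},
    forall h : M -> R, continuous h ->
      wmean (N j) (w j) (x j) h @[j --> \oo] --> rint nu h.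
Proof.
move=> w01 cvgG.
have G0 n : G n 0%N = 0.
  apply: cvg_unique (cvgG n 0%N) _ => //; apply: cvg_near_cst; apply: nearW => j.
  by rewrite /wmean big1 ?mulr0// => i _; rewrite /cell_below ltn0 mulr0.
have Gmono n : {homo G n : k l / (k <= l)%N >-> k <= l}.
  move=> k l kl; apply: ler_cvg_to (cvgG n k) (cvgG n l) _.
  apply: nearW => j; apply: le_wmean => // y; rewrite /cell_below ler_nat.
  by case: ltnP => // /leq_trans /(_ kl) ->.
have Gdouble n k : G n.+1 k.*2 = G n k.
  apply: cvg_unique (cvgG n.+1 k.*2) _ => //; apply: cvg_trans (cvgG n k).
  rewrite (_ : cell_below n.+1 k.*2 = cell_below n k)//.
  by apply/funext => y; rewrite /cell_below codeS_lt_double.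
have [P PE] := cell_law G G0 Gmono Gdouble.
pose F : measurableTypeR R -> borel M := fun t => f (decode G t).
have mcell n k : measurable ([set t | cell G n t = k] : set (measurableTypeR R)).
  exact: measurable_cell.
have mF : measurable_fun setT F.
  apply: (@measurability _ _ (measurableTypeR R) (borel M) setT F (@open M) erefl).
  move=> _ [U oU <-]; rewrite setTI.
  (* Each point of the open preimage of [U] under [f] has a cylinder inside it, so only countably
     many measurable cells are needed. *)
  have -> : F @^-1` U = \bigcup_n \bigcup_(k in [set k | forall b : cantor_space,
      code n b = k -> U (f b)]) [set t | cell G n t = k].
    apply/seteqP; split=> t /=.
      move=> Ut; have : nbhs (decode G t : cantor_space) (f @^-1` U).
        by apply: cf; exact: open_nbhs_nbhs.
      move=> /cantor_cell_basis[n nU]; exists n => //.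
      exists (cell G n t) => //= b bt; apply: nU.
      by rewrite bt code_decode.
    by case=> n _ [k /= kU tk]; apply: kU; rewrite code_decode.
  apply: bigcupT_measurable => n; apply: bigcup_measurable => k _.
  exact: mcell.
exists (image_measure P F mF) => h ch.
have [K hK] := compact_continuous_bounded h cM ch.
have mhF : measurable_fun setT (h \o F).
  by apply: measurableT_comp mF; exact: continuous_borel_measurable.
have -> : rint (image_measure P F mF) h = \int[P]_t h (F t).
  rewrite /rint /Rintegral; congr fine; rewrite integral_pushforward//.
  - by apply/measurable_EFinP; exact: continuous_borel_measurable.
  - exact: integrable_bounded (fun t => hK (F t)).
pose C := fine (P setT).
have C0 : 0 <= C by apply: fine_ge0.
(* The errors below are [r * C] from integration, [r] from the limit of the step means and [r] at
   the samples, in all less than [r * (C + 3)]. *)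
apply/cvgrPdist_lt => e e0; pose r := e / (C + 3).
have r0 : 0 < r by rewrite divr_gt0// ltr_wpDl.
have [n nr] := cantor_uniform (h \o f) r (fun b => continuous_comp (cf b) (ch _)) r0.
(* The default [point] occurs only when [k] is the code of no sequence. *)
pose a k := h (f (xget point [set b : cantor_space | code n b = k])).
have aE b : `|h (f b) - a (code n b)| < r.
  by apply: nr; rewrite (xgetPex point (ex_intro (fun b' => code n b' = code n b) b erefl)).
(* Consecutive [cell_below] differ by the indicator of the cylinder [k]. *)
pose step y := \sum_(k < 2 ^ n) a k * (cell_below n k.+1 y - cell_below n k y).
have stepE y : step y = a (code n (s y)).
  rewrite -(sum_cell n a _ (code_lt n (s y))); apply: eq_bigr => k _; congr (_ * _).
  rewrite /cell_below ltnS; have [] := ltngtP (code n (s y)) k;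
    by rewrite ?subrr ?subr0.
pose S := \sum_(k < 2 ^ n) a k * (G n k.+1 - G n k).
have cvgS : wmean (N j) (w j) (x j) step @[j --> \oo] --> S.
  under eq_fun do rewrite (wmean_sum _ _ _ _ a (fun k y => cell_below n k.+1 y - cell_below n k y)).
  apply: cvg_big => [|k _]; first exact: add_continuous.
  apply: cvgM; first exact: cvg_cst.
  under eq_fun do rewrite wmeanB.
  exact: cvgB.
pose u (t : measurableTypeR R) := \sum_(k < 2 ^ n) a k * \1_[set t | cell G n t = k] t.
have uE t : u t = a (cell G n t).
  rewrite -(sum_cell n a (cell G n t)); last by rewrite -code_decode code_lt.
  apply: eq_bigr => k _; rewrite indicE; congr (_ * (nat_of_bool _)%:R).
  by apply/idP/eqP => [/set_mem//|?]; exact/mem_set.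
have mu : measurable_fun setT u.
  by apply: measurable_sum => k; apply: measurable_funM.
have uS : \int[P]_t u t = S.
  rewrite (Rintegral_simple P _ a (fun k => [set t | cell G n t = k]))//.
  by apply: eq_bigr => k _; rewrite PE ?ltn_ord.
have ur t : `|h (F t) - u t| <= r.
  by rewrite uE -code_decode; exact: ltW (aE _).
have uK t : `|u t| <= K by rewrite uE; exact: hK.
have hFu : `|\int[P]_t h (F t) - S| <= r * C.
  rewrite -uS -RintegralB//; last 2 first.
  - exact: integrable_bounded mhF (fun t => hK (F t)).
  - exact: integrable_bounded mu uK.
  have mhu : measurable_fun setT (fun t => h (F t) - u t) by exact: measurable_funB.
  apply: le_trans (le_normr_Rintegral _ _) _ => //.
    exact: integrable_bounded mhu ur.
  rewrite /C -Rintegral_cst//; apply: le_Rintegral => //.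
  - apply: (integrable_bounded P _ r); first exact: measurableT_comp.
    by move=> t; rewrite normr_id.
  - by apply: (integrable_bounded P _ `|r|).
near=> j.
have step_j : `|S - wmean (N j) (w j) (x j) step| < r.
  by near: j; move/cvgrPdist_lt : cvgS; apply.
have h_j : `|wmean (N j) (w j) (x j) (fun y => step y - h y)| <= r.
  apply: normr_wmean_le => //; first exact: ltW.
  by move=> y; rewrite stepE distrC -{1}(fs y); exact: ltW (aE _).
have er : e = r * (C + 3) by rewrite /r divfK// gt_eqF// ltr_wpDl.
move: h_j step_j hFu; rewrite wmeanB ltr_norml !ler_norml ltr_norml er.
by lra.
Unshelve. all: by end_near. Qed.
End cell_measure.

(** * Complex moduli, continuity, and EDMD at the sample points *)

Section edmd.
Context {R : realType} {M : pointedMetricType R}.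
Local Notation C := R[i].
Implicit Types (z : C) (h : M -> C).

Lemma Re_mul z1 z2 : complex.Re (z1 * z2) =
  complex.Re z1 * complex.Re z2 - complex.Im z1 * complex.Im z2.
Proof. by case: z1 z2 => [a b] [c d]. Qed.

Lemma Im_mul z1 z2 : complex.Im (z1 * z2) =
  complex.Re z1 * complex.Im z2 + complex.Im z1 * complex.Re z2.
Proof. by case: z1 z2 => [a b] [c d]. Qed.

Lemma cabs_sqr z : cabs z ^+ 2 = complex.Re z ^+ 2 + complex.Im z ^+ 2.
Proof. by rewrite sqr_sqrtr// addr_ge0// sqr_ge0. Qed.

Lemma cabs_ge0 z : 0 <= cabs z.
Proof. exact: sqrtr_ge0. Qed.

Lemma Re_le_cabs z : `|complex.Re z| <= cabs z.
Proof. by rewrite -sqrtr_sqr ler_wsqrtr// lerDl sqr_ge0. Qed.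

Lemma Im_le_cabs z : `|complex.Im z| <= cabs z.
Proof. by rewrite -sqrtr_sqr ler_wsqrtr// lerDr sqr_ge0. Qed.

Lemma cabs_le z : cabs z <= `|complex.Re z| + `|complex.Im z|.
Proof.
rewrite -(@ler_pXn2r _ 2)// ?nnegrE ?cabs_ge0 ?addr_ge0// cabs_sqr.
rewrite -(real_normK (num_real (complex.Re z))) -(real_normK (num_real (complex.Im z))).
have := normr_ge0 (complex.Re z); have := normr_ge0 (complex.Im z).
by nra.
Qed.

Lemma ccontinuousD h1 h2 : ccontinuous h1 -> ccontinuous h2 ->
  ccontinuous (fun y => h1 y + h2 y).
Proof.
move=> [r1 i1] [r2 i2]; split=> y.
  under eq_fun do rewrite raddfD /=.
  by apply: cvgD; [exact: r1|exact: r2].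
under eq_fun do rewrite raddfD /=.
by apply: cvgD; [exact: i1|exact: i2].
Qed.

Lemma ccontinuousZ z h : ccontinuous h -> ccontinuous (fun y => z * h y).
Proof.
move=> [rh ih]; split=> y.
  under eq_fun do rewrite Re_mul.
  by apply: cvgB; apply: cvgM; (try exact: cvg_cst); [exact: rh|exact: ih].
under eq_fun do rewrite Im_mul.
by apply: cvgD; apply: cvgM; (try exact: cvg_cst); [exact: ih|exact: rh].
Qed.

Lemma ccontinuous_comp h (g : M -> M) : continuous g -> ccontinuous h ->
  ccontinuous (h \o g).
Proof.
by move=> cg [rh ih]; split=> y;
  [exact: (continuous_comp (cg y) (rh _))|exact: (continuous_comp (cg y) (ih _))].
Qed.

Lemma of_coef_continuous (psi : nat -> M -> C) N (c : 'cV[C]_N) :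
  (forall j, ccontinuous (psi j)) -> ccontinuous (of_coef psi c).
Proof.
move=> cpsi; have -> : of_coef psi c = fun y => \sum_(j < N) conjc (c j 0) * psi j y.
  by apply/funext => y; rewrite /of_coef mxE; apply: eq_bigr => j _; rewrite !mxE.
elim: (index_enum _) => [|j r IHr].
  by split=> y; under eq_fun do rewrite big_nil; exact: cvg_cst.
under eq_fun do rewrite big_cons.
by apply: ccontinuousD => //; exact: ccontinuousZ.
Qed.

Lemma cabs_le_supnorm h y : compact [set: M] -> ccontinuous h ->
  cabs (h y) <= supnorm h.
Proof.
move=> cM [ch1 ch2].
have [K1 hK1] := compact_continuous_bounded _ cM ch1.
have [K2 hK2] := compact_continuous_bounded _ cM ch2.
apply: ub_le_sup; last by exists y.
exists (K1 + K2) => _ [z _ <-].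
by apply: le_trans (cabs_le _) _; apply: lerD; [exact: hK1|exact: hK2].
Qed.

(** The inverse satisfies the Penrose conditions, so the choice in [mpinv] does not fall back on its
    default; cancelling [A] on both sides of [A *m mpinv A *m A = A] then identifies it. *)
Lemma mpinv_unit n (A : 'M[C]_n) : A \in unitmx -> mpinv A = invmx A.
Proof.
move=> uA; have /(xgetPex 0) [AP _ _ _] : exists P, is_mpinv A P.
  exists (invmx A); rewrite /is_mpinv mulmxV// mulVmx//.
  have ct1 : ctmx (1%:M : 'M[C]_n) = 1%:M.
    by apply/matrixP => i j; rewrite !mxE eq_sym conjc_nat.
  by split; rewrite ?mul1mx// ct1.
have {}AP : A *m mpinv A *m A = A by [].
have AP1 : A *m mpinv A = 1%:M by rewrite -[LHS](mulmxK uA) AP mulmxV.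
by rewrite -[LHS](mulKmx uA) AP1 mulmx1.
Qed.

(** The Gram matrix is [psiX] times a multiple of its conjugate transpose. With as many samples as
    functions both factors are square, so invertibility passes to each. *)
Lemma psiX_unit (psi : nat -> M -> C) N (x : nat -> M) :
  gram psi N x \in unitmx -> psiX psi N x \in unitmx.
Proof.
have -> : gram psi N x = psiX psi N x *m (N%:R^-1 *: ctmx (psiX psi N x)).
  rewrite /gram -scalemxAr; congr (_ *: _); apply/matrixP => i j.
  rewrite summxE mxE; apply: eq_bigr => k _.
  by rewrite !mxE big_ord_recl big_ord0 addr0 !mxE.
by rewrite unitmx_mul => /andP[].
Qed.

(** EDMD interpolates at the samples: [psivec psi N (x i)] is a column of [psiX], so the inverse of
    [psiX] sends it to a basis vector, which [psiY] sends to the values at [T (x i)]. *)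
Lemma edmd_eigen_sample (psi : nat -> M -> C) T N x lam phi :
  gram psi N x \in unitmx -> edmd_eigenpair psi T N x lam phi ->
  forall i, (i < N)%N -> phi (T (x i)) = lam * phi (x i).
Proof.
move=> /psiX_unit uX [_ [c [-> opc]]] i iN; rewrite -opc /edmd_op /of_coef.
have -> : psivec psi N (x i) = col (Ordinal iN) (psiX psi N x).
  by apply/colP => j; rewrite !mxE.
rewrite /edmd_mx mpinv_unit// colE !mulmxA mulmxKV// -mulmxA -colE.
by congr ((_ *m _) 0 0); apply/colP => j; rewrite !mxE.
Qed.
End edmd.

(** * Limits of complex sequences *)

Section complex_limits.
Context {R : realType}.
Local Notation C := R[i].
Implicit Types (u v : nat -> C) (l z : C).

Lemma cabsM z1 z2 : cabs (z1 * z2) = cabs z1 * cabs z2.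
Proof.
apply/eqP; rewrite -(@eqrXn2 _ 2)// ?mulr_ge0 ?cabs_ge0//; apply/eqP.
by rewrite exprMn !cabs_sqr Re_mul Im_mul; ring.
Qed.

Lemma ccvgP u l : ccvg u l <->
  (complex.Re (u n) @[n --> \oo] --> complex.Re l) /\
  (complex.Im (u n) @[n --> \oo] --> complex.Im l).
Proof.
split=> [ul|[rl il]].
  split; apply/cvgrPdist_lt => e e0; move/cvgrPdist_lt/(_ e e0): ul;
    apply: filterS => n; rewrite sub0r normrN (ger0_norm (cabs_ge0 _)) distrC -raddfB.
    exact: le_lt_trans (Re_le_cabs _).
  exact: le_lt_trans (Im_le_cabs _).
rewrite /ccvg; apply: (@squeeze_cvgr _ _ _ _ (cst 0)
  (fun n => `|complex.Re (u n) - complex.Re l| + `|complex.Im (u n) - complex.Im l|)).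
- by apply: nearW => n; rewrite cabs_ge0 /= -!raddfB cabs_le.
- exact: cvg_cst.
- rewrite -[X in _ --> X]addr0; apply: cvgD; apply/norm_cvg0P.
    by apply/subr_cvg0.
  by apply/subr_cvg0.
Qed.

Lemma ccvg_unique {u l1 l2} : ccvg u l1 -> ccvg u l2 -> l1 = l2.
Proof.
move=> /ccvgP[r1 i1] /ccvgP[r2 i2]; apply/eqP; rewrite eq_complex; apply/andP.
by split; apply/eqP; [apply: cvg_unique r1 r2|apply: cvg_unique i1 i2].
Qed.

Lemma ccvgM u v l z : ccvg u l -> ccvg v z -> ccvg (fun n => u n * v n) (l * z).
Proof.
move=> /ccvgP[ru iu] /ccvgP[rv iv]; apply/ccvgP; rewrite Re_mul Im_mul.
split.
  under eq_fun do rewrite Re_mul.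
  by apply: cvgB; exact: cvgM.
under eq_fun do rewrite Im_mul.
by apply: cvgD; exact: cvgM.
Qed.

Lemma ccvg_close u v l (N : nat -> nat) K : (forall k, (k < N k)%N) ->
  (forall k, cabs (v k - u k) <= K / (N k)%:R) -> ccvg u l -> ccvg v l.
Proof.
move=> kN uvK ul.
have K0 : 0 <= K.
  have N0 : 0 < (N 0%N)%:R :> R by rewrite ltr0n.
  by have := le_trans (cabs_ge0 _) (uvK 0%N); rewrite pmulr_lge0// invr_gt0.
have cK : K / (N k)%:R @[k --> \oo] --> (0 : R).
  apply: (@squeeze_cvgr _ _ _ _ (cst 0) (fun k => K * k.+1%:R^-1)).
  - apply: nearW => k; rewrite /= divr_ge0//= ler_wpM2l// lef_pV2 ?posrE ?ltr0n//.
      by rewrite ler_nat.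
    exact: leq_ltn_trans (kN k).
  - exact: cvg_cst.
  - by rewrite -[X in _ --> X](mulr0 K); apply: cvgM; [exact: cvg_cst|exact: cvg_harmonic].
have cd : ccvg (fun k => v k - u k) 0.
  rewrite /ccvg; apply: (@squeeze_cvgr _ _ _ _ (cst 0) (fun k => K / (N k)%:R)) => //.
    by apply: nearW => k; rewrite /= subr0 cabs_ge0 uvK.
  exact: cvg_cst.
move: cd ul => /ccvgP[rd id] /ccvgP[ru iu]; apply/ccvgP; split.
  have -> : (fun k => complex.Re (v k)) = (fun k => complex.Re (v k - u k) + complex.Re (u k)).
    by apply/funext => k; rewrite raddfB subrK.
  by rewrite -[complex.Re l]add0r; exact: cvgD.
have -> : (fun k => complex.Im (v k)) = (fun k => complex.Im (v k - u k) + complex.Im (u k)).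
  by apply/funext => k; rewrite raddfB subrK.
by rewrite -[complex.Im l]add0r; exact: cvgD.
Qed.

End complex_limits.

(** * Telescoping along orbits, and sums of finite measures *)

Lemma telescope_orbit {X : Type} {V : zmodType} (T : X -> X) (x : nat -> X) N (g : X -> V) :
  (forall i, (i.+1 < N.+1)%N -> x i.+1 = T (x i)) ->
  \sum_(i < N.+1) g (T (x i)) - \sum_(i < N.+1) g (x i) = g (T (x N)) - g (x 0%N).
Proof.
move=> xT; rewrite big_ord_recr [X in _ - X]big_ord_recl /=.
rewrite (eq_bigr (fun i : 'I_N => g (x i.+1))); last by move=> i _; rewrite xT// ltnS.
by rewrite opprD [X in _ + X]addrC addrACA subrr add0r.
Qed.

Section measure_sum.
Context {R : realType} {M : pointedMetricType R}.
Variables m1 m2 : {finite_measure set (borel M) -> \bar R}.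

(** A name of its own for the sum, to carry the finite measure structure that [finite_measure_ext]
    asks for. *)
Definition finite_add : set (borel M) -> \bar R := measure_add m1 m2.

HB.instance Definition _ := Measure.copy finite_add
  (msum (fun n => if n is 0%N then m1 : {measure set _ -> \bar R} else m2) 2).

Let finite_add_fin : fin_num_fun finite_add.
Proof.
move=> A mA; rewrite /finite_add measure_addE.
by rewrite fin_numD !fin_num_measure.
Qed.

HB.instance Definition _ := Measure_isFinite.Build _ _ _ finite_add finite_add_fin.

Lemma finite_measure_sum (mu : {finite_measure set (borel M) -> \bar R}) :
  compact [set: M] ->
  (forall f : M -> R, continuous f -> rint mu f = rint m1 f + rint m2 f) ->
  forall A, measurable A -> (mu A = m1 A + m2 A)%E.
Proof.
move=> cM muE A mA; rewrite -measure_addE.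
apply: (finite_measure_ext mu finite_add) => // f cf; rewrite muE//.
rewrite /rint /Rintegral.
have -> : (\int[finite_add]_x (f x)%:E = \int[m1]_x (f x)%:E + \int[m2]_x (f x)%:E)%E.
  rewrite integral_measure_add//; try exact: continuous_borel_integrable.
have fin (m : {finite_measure set (borel M) -> \bar R}) :
    (\int[m]_x (f x)%:E)%E \is a fin_num.
  by apply: integrable_fin_num => //; exact: continuous_borel_integrable.
by rewrite (fineD (fin m1) (fin m2)).
Qed.

End measure_sum.

(** * The Koopman adjoint as composition with the inverse map *)

Section koopman_adjoint.
Context {R : realType} {M : pointedMetricType R}.
Local Notation C := R[i].
Variable mu : {finite_measure set (borel M) -> \bar R}.
Hypothesis cM : compact [set: M].

Local Notation measurableC f :=
  (measurable_fun [set: borel M] ((fun y => complex.Re (f y)) : borel M -> R) /\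
   measurable_fun [set: borel M] ((fun y => complex.Im (f y)) : borel M -> R)).

Lemma L2_ccontinuous (h : M -> C) : ccontinuous h -> L2 mu h.
Proof.
move=> [rh ih].
have mr := continuous_borel_measurable _ rh; have mi := continuous_borel_measurable _ ih.
have [K1 hK1] := compact_continuous_bounded _ cM rh.
have [K2 hK2] := compact_continuous_bounded _ cM ih.
split=> //; apply: (integrable_bounded mu (fun y : borel M => cabs (h y) ^+ 2) (K1 ^+ 2 + K2 ^+ 2)).
  under eq_fun do rewrite cabs_sqr.
  by apply: measurable_funD; exact: measurable_funX.
move=> y; rewrite ger0_norm ?sqr_ge0// cabs_sqr -real_normK ?num_real//.
rewrite -[X in _ + X <= _]real_normK ?num_real//.
by apply: lerD; rewrite lerXn2r ?nnegrE// (le_trans (normr_ge0 _) (hK1 y)) ||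
  rewrite lerXn2r ?nnegrE// (le_trans (normr_ge0 _) (hK2 y)).
Qed.

Lemma L2B (f g : M -> C) : L2 mu f -> L2 mu g -> L2 mu (fun y => f y - g y).
Proof.
move=> [rf jf sf] [rg jg sg].
have mr : measurable_fun [set: borel M] ((fun y => complex.Re (f y - g y)) : borel M -> R).
  by under eq_fun do rewrite raddfB; exact: measurable_funB.
have mi : measurable_fun [set: borel M] ((fun y => complex.Im (f y - g y)) : borel M -> R).
  by under eq_fun do rewrite raddfB; exact: measurable_funB.
split=> //.
(* The dominating function comes from [|f - g|^2 <= 2 (|f|^2 + |g|^2)], where the gap is
   [|f + g|^2]. *)
have s : mu.-integrable setT
    (EFin \o (fun y : borel M => 2 * (cabs (f y) ^+ 2 + cabs (g y) ^+ 2))).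
  exact: (integrableZl measurableT 2 (integrableD measurableT sf sg)).
apply: le_integrable s => //.
  apply/measurable_EFinP; under eq_fun do rewrite cabs_sqr.
  by apply: measurable_funD; exact: measurable_funX.
move=> y _ /=; rewrite lee_fin !ger0_norm ?sqr_ge0 ?mulr_ge0 ?addr_ge0 ?sqr_ge0//.
rewrite !cabs_sqr !raddfB /=.
set a := complex.Re (f y); set b := complex.Im (f y).
set c := complex.Re (g y); set d := complex.Im (g y).
rewrite -subr_ge0 (_ : _ - _ = (a + c) ^+ 2 + (b + d) ^+ 2); last by ring.
by rewrite addr_ge0 ?sqr_ge0.
Qed.

Lemma Re_mul_conjc (z1 z2 : C) : complex.Re (z1 * conjc z2) =
  complex.Re z1 * complex.Re z2 + complex.Im z1 * complex.Im z2.
Proof. by case: z1 z2 => [a b] [c d] /=; rewrite mulrN opprK. Qed.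

Lemma Re_inner_integrable (f g : M -> C) : L2 mu f -> L2 mu g ->
  mu.-integrable setT (EFin \o (fun y : borel M => complex.Re (f y * conjc (g y)))).
Proof.
move=> [rf jf sf] [rg jg sg]; have s := integrableD measurableT sf sg.
apply: le_integrable s => //.
  apply/measurable_EFinP; under eq_fun do rewrite Re_mul_conjc.
  by apply: measurable_funD; exact: measurable_funM.
move=> y _ /=; rewrite lee_fin (ger0_norm (addr_ge0 _ _)) ?sqr_ge0//.
rewrite !cabs_sqr Re_mul_conjc.
set a := complex.Re (f y); set b := complex.Im (f y).
set c := complex.Re (g y); set d := complex.Im (g y).
have := sqr_ge0 (a + c); have := sqr_ge0 (a - c).
have := sqr_ge0 (b + d); have := sqr_ge0 (b - d).
rewrite ler_norml; have := sqr_ge0 a; have := sqr_ge0 b; have := sqr_ge0 c.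
have := sqr_ge0 d; nra.
Qed.

Variables (T Tinv : M -> M).
Hypotheses (cT : continuous T) (cTinv : continuous Tinv) (TK : cancel T Tinv).
Hypothesis inv : forall f : M -> R, continuous f -> rint mu (f \o T) = rint mu f.

(** By [inv] the image of [mu] under [T] and [mu] itself integrate continuous functions alike, so
    they agree on Borel sets. This carries invariance to integrands built from [Kstar h], which are
    merely measurable. *)
Lemma invariant_rint (u : M -> R) :
  measurable_fun [set: borel M] (u : borel M -> R) ->
  mu.-integrable setT (EFin \o ((u \o T) : borel M -> R)) ->
  rint mu (u \o T) = rint mu u.
Proof.
have mT := continuous_self_map_measurable _ cT.
have imE (v : M -> R) : measurable_fun [set: borel M] (v : borel M -> R) ->
    mu.-integrable setT (EFin \o ((v \o T) : borel M -> R)) ->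
    rint (image_measure mu _ mT) v = rint mu (v \o T).
  move=> mv iv; rewrite /rint /Rintegral; congr fine.
  by rewrite integral_pushforward//; exact/measurable_EFinP.
move=> mu_ iu; rewrite -imE// /rint /Rintegral; congr fine.
apply: eq_measure_integral => A mA _.
apply: (finite_measure_ext (image_measure mu _ mT) mu) => // f cf.
rewrite imE ?inv//; first exact: continuous_borel_measurable.
apply: (continuous_borel_integrable mu (f \o T)) => // y.
exact: (continuous_comp (cT y) (cf _)).
Qed.

Lemma koopman_adjoint_ae (Kstar : (M -> C) -> (M -> C)) (h : M -> C) :
  koopman_bounded T mu -> koopman_adjoint T mu Kstar -> ccontinuous h ->
  measurableC (Kstar h) /\
  exists A : set (borel M), [/\ measurable A, mu A = 0%E &
    forall y, ~ A y -> Kstar h y = h (Tinv y)].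
Proof.
move=> [K bK] adj ch; have Lh := L2_ccontinuous h ch.
have [LKh adjh] := adj h Lh; split; first by case: LKh.
have LhT := L2_ccontinuous _ (ccontinuous_comp h Tinv cTinv ch).
pose g y := Kstar h y - h (Tinv y).
have Lg : L2 mu g := L2B _ _ LKh LhT.
(* Boundedness of the Koopman operator places [g \o T] in [L2], which makes [q \o T] below
   integrable. *)
have [LgT _] := bK g Lg.
have i1 := Re_inner_integrable _ _ Lg LKh.
have i2 := Re_inner_integrable _ _ Lg LhT.
have i3 := Re_inner_integrable _ _ LgT Lh.
pose q y := complex.Re (g y * conjc ((h \o Tinv) y)).
have qT : (q \o T) = fun y => complex.Re ((g \o T) y * conjc (h y)).
  by apply/funext => y; rewrite /q /= TK.
have := congr1 (@complex.Re R) (adjh g Lg); rewrite /cinner /cintm /= => e.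
(* The real part of [<g, Kstar h> = <g \o T, h> = <g, h \o Tinv>]: the adjoint relation, then
   invariance of [mu]. *)
have {}e : rint mu (fun y => complex.Re (g y * conjc (Kstar h y))) = rint mu q.
  rewrite -e -(invariant_rint q) ?qT//.
  by move/integrableP : i2 => [/measurable_EFinP].
have g0 : (\int[mu]_y (cabs (g y) ^+ 2)%:E = 0)%E.
  have [_ _ ig] := Lg.
  rewrite -(fineK (integrable_fin_num measurableT ig)); congr EFin.
  rewrite -/(Rintegral mu setT (fun y : borel M => cabs (g y) ^+ 2)).
  rewrite (_ : (fun y : borel M => cabs (g y) ^+ 2) =
      fun y => complex.Re (g y * conjc (Kstar h y)) - q y); last first.
    apply/funext => y; rewrite /q !Re_mul_conjc cabs_sqr /g /= !raddfB /=; ring.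
  by rewrite RintegralB//; apply/eqP; rewrite subr_eq0; apply/eqP.
have [_ _ ig] := Lg.
have [+ _] := ae_eq_integral_abs mu measurableT (measurable_int mu ig).
rewrite (_ : (\int[mu]_x _ = 0)%E); last first.
  by rewrite -[RHS]g0; apply: eq_integral => y _; rewrite gee0_abs// lee_fin sqr_ge0.
move=> /(_ erefl)[A [mA A0 sA]]; exists A; split=> // y Ay.
have : (cabs (g y) ^+ 2)%:E = 0%E.
  by apply: contrapT => gy; apply: Ay; apply: sA => /= /(_ I).
move=> [] /eqP; rewrite cabs_sqr paddr_eq0 ?sqr_ge0// !sqrf_eq0 => gy.
by apply/eqP; rewrite -subr_eq0 eq_complex.
Qed.

Lemma rint_ae (m : {finite_measure set (borel M) -> \bar R}) (A : set (borel M))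
    (u v : M -> R) :
  measurable A -> m A = 0%E ->
  measurable_fun [set: borel M] (u : borel M -> R) ->
  measurable_fun [set: borel M] (v : borel M -> R) ->
  (forall y, ~ A y -> u y = v y) -> rint m u = rint m v.
Proof.
move=> mA A0 mu_ mv uv; rewrite /rint /Rintegral; congr fine.
apply: ae_eq_integral => //; try exact/measurable_EFinP.
exists A; split=> // y /= nuv; apply: contrapT => Ay; apply: nuv => _.
by rewrite uv.
Qed.

End koopman_adjoint.

(** * Empirical integrals split into nonnegative weights *)

Section empirical.
Context {R : realType} {M : pointedMetricType R}.
Local Notation C := R[i].

(* Positive and negative parts of the real and imaginary parts; the indices
   0, 1, 2, 3 correspond to [cm1], [cm2], [cm3], [cm4]. *)
Definition part (a : nat) (z : C) : R :=
  match a with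
  | 0 => Num.max (complex.Re z) 0
  | 1 => Num.max (- complex.Re z) 0
  | 2 => Num.max (complex.Im z) 0
  | _ => Num.max (- complex.Im z) 0
  end.

Lemma part01 a z : cabs z <= 1 -> 0 <= part a z <= 1.
Proof.
move=> z1; have := Re_le_cabs z; have := Im_le_cabs z; rewrite !ler_norml.
move=> /andP[i0 i1] /andP[r0 r1].
by case: a => [|[|[|a]]] /=; rewrite le_max lexx orbT ge_max ler01 andbT; lra.
Qed.

Lemma maxr0_sub (r : R) : Num.max r 0 - Num.max (- r) 0 = r.
Proof.
by have [r0|r0] := leP r 0; have [r0'|r0'] := leP (- r) 0; lra.
Qed.

(* [None] is the weight 1; [Some (a, b)] is the a-th part, or its complement
   to 1 when [b] holds. *)
Definition weight (o : option (nat * bool)) (z : C) : R :=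
  if o is Some (a, b) then (if b then 1 - part a z else part a z) else 1.

Lemma weight01 o z : cabs z <= 1 -> 0 <= weight o z <= 1.
Proof.
move=> z1; case: o => [[a [|]]|] /=; rewrite ?ler01 ?lexx//; have := part01 a z z1; lra.
Qed.

(** The integral of [h] against [(I0 - I1) + i (I2 - I3)], for real functionals. Both [cint] and
    [emp_wint] have this form, so convergence is checked on the four real functionals. *)
Definition combine (I : nat -> (M -> R) -> R) (h : M -> C) : C :=
  Complex
    (I 0%N (fun y => complex.Re (h y)) - I 1%N (fun y => complex.Re (h y))
     - (I 2 (fun y => complex.Im (h y)) - I 3 (fun y => complex.Im (h y))))
    (I 0%N (fun y => complex.Im (h y)) - I 1%N (fun y => complex.Im (h y))
     + (I 2 (fun y => complex.Re (h y)) - I 3 (fun y => complex.Re (h y)))).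

Lemma ccvg_combine (I : nat -> nat -> (M -> R) -> R) J (h : M -> C) :
  ccontinuous h ->
  (forall a g, continuous g -> I k a g @[k --> \oo] --> J a g) ->
  ccvg (fun k => combine (I k) h) (combine J h).
Proof.
move=> [rh ih] IJ; apply/ccvgP; split.
  by apply: cvgB; apply: cvgB; exact: IJ.
by apply: cvgD; apply: cvgB; exact: IJ.
Qed.

Lemma cint_combine (m : nat -> {finite_measure set (borel M) -> \bar R}) h :
  cint (CMeasure (m 0%N) (m 1%N) (m 2) (m 3)) h = combine (fun a => rint (m a)) h.
Proof.
rewrite /cint /combine /cintm /=; apply/eqP; rewrite eq_complex; apply/andP.
by split; apply/eqP; rewrite /= !(mul0r, mul1r, sub0r, addr0, add0r).
Qed.

Lemma invC_natE N : (N%:R : C)^-1 = Complex (N%:R^-1) 0.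
Proof. by rewrite -[RHS]/(real_complex R _) fmorphV rmorph_nat. Qed.

Lemma emp_wint_combine N x (phi h : M -> C) :
  emp_wint N x phi h = combine (fun a => wmean N (fun i => part a (phi (x i))) x) h.
Proof.
rewrite /emp_wint invC_natE; apply/eqP; rewrite eq_complex; apply/andP.
rewrite Re_mul Im_mul /= !mul0r subr0 addr0 !raddf_sum /wmean -!mulrBr -?mulrDr -!sumrB -?big_split /=.
(* The real and imaginary parts of [phi] are replaced by differences of their positive and negative
   parts, leaving polynomial identities. *)
split; apply/eqP; congr (_ * _); apply: eq_bigr => i _; rewrite ?Re_mul ?Im_mul;
  have := maxr0_sub (complex.Re (phi (x i))); have := maxr0_sub (complex.Im (phi (x i)));
  generalize (Num.max (complex.Re (phi (x i))) 0) (Num.max (- complex.Re (phi (x i))) 0)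
    (Num.max (complex.Im (phi (x i))) 0) (Num.max (- complex.Im (phi (x i))) 0);
  by move=> p0 p1 p2 p3 <- <-; ring.
Qed.

Lemma emp_intE N x (h : M -> C) : emp_int N x h =
  Complex (wmean N (fun=> 1) x (fun y => complex.Re (h y)))
          (wmean N (fun=> 1) x (fun y => complex.Im (h y))).
Proof.
rewrite /emp_int invC_natE; apply/eqP; rewrite eq_complex; apply/andP.
rewrite Re_mul Im_mul /= !mul0r subr0 addr0 !raddf_sum /wmean.
by split; apply/eqP; congr (_ * _); apply: eq_bigr => i _; rewrite mul1r.
Qed.

Lemma cabsB_le (z1 z2 : C) : cabs (z1 - z2) <= cabs z1 + cabs z2.
Proof.
rewrite -(@ler_pXn2r _ 2)// ?nnegrE ?cabs_ge0 ?addr_ge0 ?cabs_ge0//.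
have conj_abs : cabs (conjc z2) = cabs z2 by case: z2 => a b; rewrite /cabs /= sqrrN.
have := Re_le_cabs (z1 * conjc z2); rewrite cabsM conj_abs Re_mul_conjc ler_norml.
rewrite sqrrD !cabs_sqr !raddfB /= => /andP[+ _].
by lra.
Qed.

Lemma cabsN (z : C) : cabs (- z) = cabs z.
Proof. by case: z => a b; rewrite /cabs /= !sqrrN. Qed.

(** Two boundary values survive the telescoping, each of modulus at most [K]. *)
Lemma cabs_mean_shift (T : M -> M) (x : nat -> M) N (g : M -> C) K :
  (0 < N)%N -> (forall i, (i.+1 < N)%N -> x i.+1 = T (x i)) ->
  (forall y, cabs (g y) <= K) ->
  cabs ((N%:R)^-1 * \sum_(i < N) g (T (x i)) - (N%:R)^-1 * \sum_(i < N) g (x i))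
    <= (K *+ 2) / N%:R.
Proof.
case: N => // N _ xT gK; rewrite -mulrBr (telescope_orbit T x N g xT) cabsM mulrC.
apply: ler_pM; rewrite ?cabs_ge0//.
  by rewrite mulr2n (le_trans (cabsB_le _ _))// lerD.
by rewrite invC_natE /cabs /= expr0n /= addr0 sqrtr_sqr ger0_norm ?invr_ge0.
Qed.
End empirical.

(** * Extraction of the limits and the eigenvalue identities *)

Theorem theorem7 (R : realType) (M : pointedMetricType R)
  (Mcompact : compact [set: M])
  (T Tinv : M -> M) (Tcont : continuous T) (Tinvcont : continuous Tinv)
  (TK : cancel T Tinv) (TinvK : cancel Tinv T)
  (psi : nat -> M -> R[i]) (psicont : forall j, ccontinuous (psi j))
  (x : nat -> nat -> M)
  (xtraj : forall N i, (i.+1 < N)%N -> x N i.+1 = T (x N i))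
  (gram_inv : forall N, (0 < N)%N -> gram psi N (x N) \in unitmx)
  (lam : nat -> R[i])
  (lam_bdd : exists B : R, forall N, (0 < N)%N -> cabs (lam N) <= B)
  (phi : nat -> M -> R[i])
  (eig : forall N, (0 < N)%N -> edmd_eigenpair psi T N (x N) (lam N) (phi N))
  (phi_norm : forall N, (0 < N)%N -> supnorm (phi N) = 1) :
  exists (Ns : nat -> nat) (nu : cmeasure M)
         (mu : {finite_measure set borel M -> \bar R}) (l : R[i]),
    [/\ (forall k, (0 < Ns k)%N /\ (Ns k < Ns k.+1)%N),
        (forall h, ccontinuous h ->
           ccvg (fun k => emp_wint (Ns k) (x (Ns k)) (phi (Ns k)) h) (cint nu h)),
        (forall h, ccontinuous h ->
           ccvg (fun k => emp_int (Ns k) (x (Ns k)) h) (cintm mu h)),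
        ccvg (fun k => lam (Ns k)) l &
        (forall h, ccontinuous h -> cint nu (h \o Tinv) = l * cint nu h)]
    /\ (forall h, ccontinuous h -> cintm mu (h \o T) = cintm mu h)
    /\ (koopman_bounded T mu ->
        forall Kstar, koopman_adjoint T mu Kstar ->
        forall h, ccontinuous h -> cint nu (Kstar h) = l * cint nu h)
    /\ (l != 0 ->
        forall h, ccontinuous h -> cint nu (h \o T) = l^-1 * cint nu h).
Proof.
have [B lamB] := lam_bdd.
have ceig N : (0 < N)%N -> ccontinuous (phi N).
  by move=> /eig[_ [c [-> _]]]; exact: of_coef_continuous.
have phi1 N y : (0 < N)%N -> cabs (phi N y) <= 1.
  by move=> N0; rewrite -(phi_norm N N0); exact: cabs_le_supnorm (ceig N N0).
have [f cf] := cantor_surj Mcompact (@metric_hausdorff R M).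
have /choice[s fs] y : exists b, f b = y.
  by have [b _ <-] := @surj _ _ _ _ f y I; exists b.
pose wt o N i := weight o (phi N (x N i)).
have wt01 o N i : (0 < N)%N -> 0 <= wt o N i <= 1.
  by move=> N0; apply: weight01; exact: phi1.
(* One countable family holds the cylinder masses for all weights and both parts of [lam N], so that
   a single subsequence serves every limit. *)
pose v (i : option (nat * bool) * (nat * nat) + bool) N : R :=
  match i with
  | inl (o, (n, k)) => wmean N (wt o N) (x N) (cell_below s n k)
  | inr b => if b then complex.Re (lam N) else complex.Im (lam N)
  end.
pose vB (i : option (nat * bool) * (nat * nat) + bool) := if i is inl _ then 1 else B.
have [Ns [lims [NsP cvgNs]]] : exists Ns : nat -> nat, exists l : _ -> R,
    (forall k, (0 < Ns k)%N /\ (Ns k < Ns k.+1)%N) /\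
    forall i, v i (Ns k) @[k --> \oo] --> l i.
  apply: (bounded_subsequence v vB) => -[[c [n k]]|[|]] N N0 /=.
  - apply: normr_wmean_le => //; first by move=> i; exact: wt01.
    by move=> y; rewrite /cell_below; case: ltnP; rewrite ?normr1 ?normr0.
  - by apply: le_trans (lamB N N0); exact: Re_le_cabs.
  - by apply: le_trans (lamB N N0); exact: Im_le_cabs.
have ltNs k : (k < Ns k)%N.
  by elim: k => [|k IHk]; [exact: (NsP 0%N).1|exact: leq_ltn_trans IHk (NsP k).2].
have /choice[nu nuP] o : exists nu : {finite_measure set (borel M) -> \bar R},
    forall h : M -> R, continuous h ->
      wmean (Ns j) (wt o (Ns j)) (x (Ns j)) h @[j --> \oo] --> rint nu h.
  apply: (cell_measure f s Mcompact cf fs Ns (fun j => wt o (Ns j)) (fun j => x (Ns j))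
    (fun n k => lims (inl (o, (n, k))))).
    by move=> j i; apply: wt01; exact: (NsP j).1.
  by move=> n k; exact: (cvgNs (inl (o, (n, k)))).
pose l : R[i] := Complex (lims (inr true)) (lims (inr false)).
pose m a := nu (Some (a, false)); pose mu := nu None.
pose nuc := CMeasure (m 0%N) (m 1%N) (m 2) (m 3).
have cvgl : ccvg (fun k => lam (Ns k)) l.
  by apply/ccvgP; split; [exact: (cvgNs (inr true))|exact: (cvgNs (inr false))].
have cvgnu h : ccontinuous h ->
    ccvg (fun k => emp_wint (Ns k) (x (Ns k)) (phi (Ns k)) h) (cint nuc h).
  move=> ch; rewrite cint_combine; under eq_fun do rewrite emp_wint_combine.
  by apply: ccvg_combine => // a g cg; exact: nuP.
have cvgmu h : ccontinuous h ->
    ccvg (fun k => emp_int (Ns k) (x (Ns k)) h) (cintm mu h).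
  move=> [rh ih]; apply/ccvgP; under eq_fun do rewrite emp_intE.
  split; first exact: (nuP None).
  by under eq_fun do rewrite emp_intE; exact: (nuP None).
have eigen N i : (i < N)%N -> phi N (T (x N i)) = lam N * phi N (x N i).
  move=> iN; have N0 : (0 < N)%N by case: N iN.
  exact: edmd_eigen_sample (gram_inv N N0) (eig N N0) i iN.
have bound (h : M -> R[i]) : ccontinuous h -> exists K, forall y, cabs (h y) <= K.
  by move=> ch; exists (supnorm h) => y; exact: cabs_le_supnorm.
have invl h : ccontinuous h -> cint nuc (h \o Tinv) = l * cint nuc h.
  move=> ch; have chT := ccontinuous_comp h Tinv Tinvcont ch.
  have [K hK] := bound _ chT.
  apply: (ccvg_unique (cvgnu _ chT)).
  apply: (@ccvg_close _ _ _ _ Ns (K *+ 2) ltNs _ (ccvgM _ _ _ _ cvgl (cvgnu h ch))) => k.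
  have N0 := (NsP k).1.
  (* At [T (x i)] this [g] equals [h (x i)] times the eigenvalue times [phi] at [x i]. Its shifted
     mean is thus [lam] times the weighted mean of [h], its plain mean the weighted mean of
     [h \o Tinv]. *)
  pose g y := (h \o Tinv) y * phi (Ns k) y.
  have gK y : cabs (g y) <= K.
    by rewrite /g cabsM -[K]mulr1 ler_pM ?cabs_ge0// phi1.
  have := cabs_mean_shift T (x (Ns k)) (Ns k) g K N0 (xtraj (Ns k)) gK.
  rewrite -[X in X <= _ -> _]/(cabs (_ - emp_wint (Ns k) (x (Ns k)) (phi (Ns k)) (h \o Tinv))).
  rewrite (_ : (Ns k)%:R^-1 * _ = lam (Ns k) * emp_wint (Ns k) (x (Ns k)) (phi (Ns k)) h).
    by rewrite -cabsN opprB.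
  rewrite /emp_wint mulrCA; congr (_ * _); rewrite mulr_sumr; apply: eq_bigr => i _.
  by rewrite /g /= TK eigen// mulrCA.
have invmu h : ccontinuous h -> cintm mu (h \o T) = cintm mu h.
  move=> ch; have [K hK] := bound h ch.
  apply: (ccvg_unique (cvgmu _ (ccontinuous_comp h T Tcont ch))).
  apply: (@ccvg_close _ _ _ _ Ns (K *+ 2) ltNs _ (cvgmu h ch)) => k.
  by apply: (cabs_mean_shift T _ _ h K) => //; [exact: (NsP k).1|exact: xtraj].
exists Ns, nuc, mu, l; split; first by split.
split=> //; split; last first.
  (* The eigenvalue identity for [h \o T], divided by [l]. *)
  move=> l0 h ch; have := invl (h \o T) (ccontinuous_comp h T Tcont ch).
  have -> : (h \o T) \o Tinv = h by apply/funext => y /=; rewrite TinvK.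
  by move=> ->; rewrite mulKf.
(* It remains to compare the integrals of [Kstar h] and [h \o Tinv] against [nuc]. *)
move=> bK Kstar adj h ch; rewrite -invl//.
have inv (g : M -> R) : continuous g -> rint mu (g \o T) = rint mu g.
  move=> cg; have cg' : ccontinuous (fun y => Complex (g y) 0).
    by split=> // y; exact: cvg_cst.
  by have /(congr1 (@complex.Re R)) := invmu _ cg'.
have [[mrK miK] [A [mA A0 KA]]] :=
  koopman_adjoint_ae mu Mcompact T Tinv Tcont Tinvcont TK inv Kstar h bK adj ch.
have mA0 a : m a A = 0%E.
  (* A part and its complement have weights adding up to 1, so [m a] is dominated by [mu] and
     inherits its null sets. *)
  have mu_sum : mu A = (m a A + nu (Some (a, true)) A)%E.
    apply: finite_measure_sum => // g cg.
    apply: (cvg_unique _ (nuP None g cg)) => //.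
    have -> : (fun j => wmean (Ns j) (wt None (Ns j)) (x (Ns j)) g) = (fun j =>
        wmean (Ns j) (wt (Some (a, false)) (Ns j)) (x (Ns j)) g +
        wmean (Ns j) (wt (Some (a, true)) (Ns j)) (x (Ns j)) g).
      apply/funext => j; rewrite /wmean -mulrDr -big_split /=; congr (_ * _).
      by apply: eq_bigr => i _; rewrite /wt /= -mulrDl addrC subrK.
    exact: cvgD (nuP (Some (a, false)) g cg) (nuP (Some (a, true)) g cg).
  by move: mu_sum; rewrite A0 => /esym/eqP; rewrite padde_eq0 ?measure_ge0// => /andP[/eqP].
have [crT ciT] := ccontinuous_comp h Tinv Tinvcont ch.
rewrite !cint_combine /combine.
have rE a : rint (m a) (fun y => complex.Re (Kstar h y)) =
    rint (m a) (fun y => complex.Re ((h \o Tinv) y)).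
  apply: (rint_ae _ A) => //; first exact: continuous_borel_measurable.
  by move=> y /KA ->.
have iE a : rint (m a) (fun y => complex.Im (Kstar h y)) =
    rint (m a) (fun y => complex.Im ((h \o Tinv) y)).
  apply: (rint_ae _ A) => //; first exact: continuous_borel_measurable.
  by move=> y /KA ->.
by rewrite !rE !iE.
Qed.
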